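(* For all $w\ge 3$ and for all $N<\frac{15+\sqrt{33}}{24}(w-2)^2$, it holds that $C(N,2,\{1,w\})\le N$. Or equivalently, $N(w)\ge\frac{15+\sqrt{33}}{24}(w-2)^2$.
   Context: An $SHF(N;n,2,\{1,w\})$ (binary separating hash family of type $\{1,w\}$) is an $N\times n$ binary matrix such that for every column $c$ and every set $D$ of $w$ other columns there is a row in which the entry of $c$ differs from the entries of all columns in $D$. $C(N,2,\{1,w\})$ denotes the maximal $n$ such that there exists an $SHF(N;n,2,\{1,w\})$. $N(w)$ denotes the minimal integer $N$ such that there exists an $SHF(N;n,2,\{1,w\})$ satisfying $n>N$.
   Formalization: An SHF(N;n,2,{1,w}) is required to have n > w columns (C is 0 if none exists); otherwise any matrix with at most w columns qualifies vacuously, so N(w) = 0 and C(0,2,{1,3}) ≥ 3, and the claim fails. *)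

(* Defs.v *)
From mathcomp Require Import all_boot all_order all_algebra.

Set Implicit Arguments.
Unset Strict Implicit.
Unset Printing Implicit Defensive.

(* [A] is an SHF(N; n, 2, {1, w}). The requirement [w < n] (at least one column
   together with w other ones) is the usual convention for separating hash
   families: without it every matrix with at most w columns would qualify
   vacuously, so that C(N, 2, {1, w}) >= w for every N, and N(w) = 0. *)
Definition is_SHF (N n w : nat) (A : 'M[bool]_(N, n)) : bool :=
  (w < n) &&
  [forall c : 'I_n, forall D : {set 'I_n},
     (c \notin D) && (#|D| == w) ==>
       [exists i : 'I_N, forall d in D, A i c != A i d]].

Definition has_SHF (N n w : nat) : bool :=
  [exists A : 'M[bool]_(N, n), is_SHF w A].

(* C(N, 2, {1, w}). For 0 < w the columns of an SHF are pairwise distinct, so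
   restricting n to n <= 2 ^ N is harmless, see [SHF_C_max] and [SHF_C_attained].
   The value is 0 if there is no SHF(N; n, 2, {1, w}) at all. *)
Definition SHF_C (N w : nat) : nat :=
  \max_(n < (2 ^ N).+1 | has_SHF N n w) n.

(* Some n > N admits an SHF(N; n, 2, {1, w}); for 0 < w the bound n <= 2 ^ N
   is again harmless, see [SHF_excessP]. *)
Definition SHF_excess (w N : nat) : bool :=
  [exists n : 'I_(2 ^ N).+1, (N < n) && has_SHF N n w].

Lemma has_SHF_leq N n w : 0 < w -> has_SHF N n w -> n <= 2 ^ N.
Proof.
move=> w_gt0 /existsP[A /andP[lt_wn /forallP sepA]].
pose f (c : 'I_n) : {ffun 'I_N -> bool} := [ffun i => A i c].
suff injf : injective f.
  have := leq_card f injf.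
  by rewrite card_ffun card_bool !card_ord.
move=> c d eq_fcd; apply/eqP/negPn/negP => neq_cd.
have [B sBB cardB] : exists2 B : {set 'I_n},
    B \subset ~: [set c; d] & #|B| = w.-1.
  have le_w : w.-1 <= #|~: [set c; d]|.
    have := cardsC [set c; d]; rewrite cards2 neq_cd card_ord => Ec.
    by rewrite -(leq_add2l 2) Ec; case: w w_gt0 lt_wn {sepA}.
  have : 0 < #|[set B : {set 'I_n} | B \subset ~: [set c; d] & #|B| == w.-1]|.
    by rewrite cards_draws bin_gt0.
  by case/card_gt0P => B; rewrite inE => /andP[? /eqP]; exists B.
have cB : c \notin B.
  by apply/negP => /(subsetP sBB); rewrite !inE eqxx.
have dB : d \notin B.
  by apply/negP => /(subsetP sBB); rewrite !inE eqxx orbT.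
have /forallP/(_ (d |: B))/implyP := sepA c.
rewrite !inE negb_or neq_cd cB cardsU1 dB cardB add1n prednK // eqxx.
case/(_ isT)/existsP => i /forall_inP/(_ d); rewrite setU11 => /(_ isT).
by have := congr1 (fun g : {ffun _} => g i) eq_fcd; rewrite !ffunE => ->; rewrite eqxx.
Qed.

Lemma SHF_C_max N n w : 0 < w -> has_SHF N n w -> n <= SHF_C N w.
Proof.
move=> w_gt0 An; have ltn := has_SHF_leq w_gt0 An.
by rewrite -ltnS in ltn; apply: (leq_bigmax_cond (Ordinal ltn)).
Qed.

Lemma SHF_C_attained N n w :
  0 < w -> has_SHF N n w -> has_SHF N (SHF_C N w) w.
Proof.
move=> w_gt0 An; have ltn := has_SHF_leq w_gt0 An; rewrite -ltnS in ltn.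
rewrite /SHF_C (bigmax_eq_arg (Ordinal ltn)) //.
by case: arg_maxnP.
Qed.

Lemma SHF_excessP w N : 0 < w ->
  reflect (exists2 n, N < n & has_SHF N n w) (SHF_excess w N).
Proof.
move=> w_gt0; apply: (iffP existsP) => [[n /andP[? ?]]|[n ltNn An]].
  by exists (n : nat).
have ltn := has_SHF_leq w_gt0 An; rewrite -ltnS in ltn.
by exists (Ordinal ltn); rewrite ltNn.
Qed.

(* Columns: the p ^ 2 non-vertical lines y = a x + b over 'F_p, for a prime
   p > w + 2. Rows: the points (x, y) with x < w + 2. Entries: incidence. *)
Lemma SHF_excess_ex w : exists N, SHF_excess w N.
Proof.
have [p lt_wp pr_p] := prime_above w.+2.
have p_gt0 := prime_gt0 pr_p.
pose row_t : finType := ('I_w.+2 * 'F_p)%type.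
pose col_t : finType := ('F_p * 'F_p)%type.
have card_r : #|row_t| = w.+2 * p by rewrite card_prod card_ord card_Fp.
have card_c : #|col_t| = p * p by rewrite card_prod card_Fp.
exists #|row_t|.
have le_c : #|col_t| < (2 ^ #|row_t|).+1.
  rewrite ltnS card_c card_r mulnC expnM.
  have le_p : p <= 2 ^ p by rewrite ltnW // ltn_expl.
  rewrite (leq_trans (leq_mul le_p le_p)) // mulnn.
  by rewrite leq_pexp2l // expn_gt0.
apply/existsP; exists (Ordinal le_c); apply/andP; split => /=.
  by rewrite card_c card_r ltn_pmul2r.
pose line (c : col_t) (x : 'I_w.+2) : 'F_p := (c.1 * (x : nat)%:R + c.2)%R.
apply/existsP; exists (\matrix_(i, j)
  ((enum_val i).2 == line (enum_val j) (enum_val i).1))%R.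
apply/andP; split.
  by rewrite card_c (leq_trans _ (leq_pmull _ p_gt0)) // (ltn_trans _ lt_wp).
apply/forallP => c; apply/forallP => D; apply/implyP => /andP[cD /eqP cardD].
have inj_x : injective (fun x : 'I_w.+2 => (x : nat)%:R%R : 'F_p).
  move=> x y /(congr1 (fun z : 'F_p => z : nat)).
  rewrite !val_Fp_nat // !modn_small ?(ltn_trans (ltn_ord _)) //.
  exact: val_inj.
have meet1 d x y : c != d ->
    line (enum_val c) x = line (enum_val d) x ->
    line (enum_val c) y = line (enum_val d) y -> x = y.
  rewrite /line -(inj_eq enum_val_inj).
  case: (enum_val c) (enum_val d) => [a b] [a' b'] /= neq Ex Ey.
  apply: inj_x; apply/eqP; rewrite -GRing.subr_eq0.
  have E : ((a - a') * ((x : nat)%:R - (y : nat)%:R) = 0)%R.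
    rewrite GRing.mulrBr !GRing.mulrBl.
    have /eqP := Ex; rewrite -GRing.subr_eq0 => /eqP Ex'.
    have -> : (a * (x : nat)%:R - a' * (x : nat)%:R = b' - b)%R.
      by apply/eqP; rewrite GRing.subr_eq GRing.addrAC -GRing.subr_eq GRing.opprK Ex GRing.addrC.
    have -> : (a * (y : nat)%:R - a' * (y : nat)%:R = b' - b)%R.
      by apply/eqP; rewrite GRing.subr_eq GRing.addrAC -GRing.subr_eq GRing.opprK Ey GRing.addrC.
    by rewrite GRing.subrr.
  have /eqP := E; rewrite GRing.mulf_eq0 => /orP[/eqP/GRing.subr0_eq Ea|//].
  move: Ex neq; rewrite Ea.
  by move/GRing.addrI=> ->; rewrite eqxx.
pose bad (d : 'I_#|col_t|) := [set x | line (enum_val c) x == line (enum_val d) x].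
have [x xP] : exists x, x \notin \bigcup_(d in D) bad d.
  apply/existsP; rewrite -negb_forall; apply/negP => /forallP allx.
  have : #|\bigcup_(d in D) bad d| <= w.
    apply: (@leq_trans (\sum_(d in D) 1)); last by rewrite sum1_card cardD.
    elim/big_rec2: _ => [|d m X dD leX].
      by rewrite cards0.
    apply: leq_trans (leq_card_setU _ _) _; apply: leq_add leX.
    apply/card_le1_eqP => x y.
    rewrite !inE => /eqP Ex /eqP Ey; apply: (meet1 d) => //.
    by apply: contraNneq cD => ->.
  have -> : \bigcup_(d in D) bad d = setT by apply/setP => x; rewrite allx inE.
  by rewrite cardsT card_ord ltnNge leqnSn.
apply/existsP; exists (enum_rank ((x, line (enum_val c) x) : row_t)).
apply/forall_inP => d dD; rewrite !mxE enum_rankK /= eqxx eq_sym eqb_id.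
by apply: contra xP => Ex; apply/bigcupP; exists d => //; rewrite inE.
Qed.

(* N(w), the least N admitting an SHF(N; n, 2, {1, w}) with n > N. *)
Definition SHF_N (w : nat) : nat := ex_minn (SHF_excess_ex w).

Lemma SHF_N_attained w : 0 < w -> exists2 n, SHF_N w < n & has_SHF (SHF_N w) n w.
Proof.
by move=> w_gt0; apply/SHF_excessP => //; rewrite /SHF_N; case: ex_minnP.
Qed.

Lemma SHF_N_min N n w : 0 < w -> N < n -> has_SHF N n w -> SHF_N w <= N.
Proof.
move=> w_gt0 ltNn An; rewrite /SHF_N; case: ex_minnP => m _; apply.
by apply/SHF_excessP => //; exists n.
Qed.

(* Main.v *)
Require Import Defs.
From mathcomp Require Import all_boot all_order all_algebra.
From mathcomp Require Import perm zify ring lra.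

(** Call a set family d-cover-free if no member is covered by d others.  The
    heart of the matter is that a d-cover-free family of n > t subsets of a
    t-set has t >= g d^2, where g = (15 + sqrt 33) / 24 is the larger root of
    12 g^2 - 15 g + 4.  Take a counterexample with t minimal.  No member has a
    point of its own, since that point and that member could be deleted; and
    deleting a member of size k together with all its points leaves a
    (d-1)-cover-free family, so that k < g (2 d - 1).  Inside a member of size
    k, join two points if they lie together in another member.  A matching with
    m edges yields a cover by k - m other members, so matchings have at most
    s = k - d - 1 edges, and the Erdos-Gallai theorem bounds the number of edges;
    hence each member has more than (t - 1) / 2 pairs of its own, contradicting
    that there are only t (t - 1) / 2 pairs.

    For a separating family of type {1, w}, complement rows so that some column
    c becomes empty.  The other columns are then (w-1)-cover-free, and
    separating c from w other columns yields a column of size at least 2.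
    Deleting that column and its rows leaves a (w-2)-cover-free family that
    still has more columns than rows. *)

Set Implicit Arguments.
Unset Strict Implicit.
Unset Printing Implicit Defensive.
Import Order.TTheory GRing.Theory Num.Theory.

(** * Matchings in graphs and the Erdos-Gallai theorem, by shifting *)

Definition offdiag (T : finType) (S : {set T}) : {set T * T} :=
  [set q | [&& q.1 != q.2, q.1 \in S & q.2 \in S]].

Lemma card_offdiag (T : finType) (S : {set T}) : #|offdiag S| = #|S| * #|S|.-1.
Proof.
have -> : offdiag S = setX S S :\: [set (x, x) | x in S].
  apply/setP => -[x y]; rewrite !inE /=.
  case: (boolP ((x \in S) && (y \in S))) => [/andP[Sx Sy]|_];
    rewrite ?andbF // !andbT.
  congr (~~ _); apply/eqP/imsetP => [->|[z _ [-> ->]]] //.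
  by exists y.
rewrite cardsD cardsX (setIidPr _); last first.
  by apply/subsetP=> _ /imsetP[x Sx ->]; rewrite inE /= Sx.
by rewrite card_imset => [|x y [] //]; rewrite -subn1 mulnBr muln1.
Qed.

(* A matching is encoded as an involution exchanging the ends of each edge, so
   that [moved mu] is the set of covered vertices: twice the number of edges. *)
Definition moved k (mu : 'I_k -> 'I_k) : {set 'I_k} := [set x | mu x != x].

Definition matching k (e : rel 'I_k) (mu : 'I_k -> 'I_k) : Prop :=
  involutive mu /\ forall x, mu x != x -> e x (mu x).

(** Non-edges are counted since they will become the own pairs of a member. *)
Definition nonedges k (e : rel 'I_k) : {set 'I_k * 'I_k} :=
  [set q | (q.1 != q.2) && ~~ e q.1 q.2].

Section Shift.
Variables (k : nat) (e : rel 'I_k).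
Hypotheses (esym : symmetric e) (eirr : irreflexive e).
Variables i j : 'I_k.

(* The vertices [z] whose edge to [j] the shift moves to [i]. *)
Definition swaps (z : 'I_k) : bool := [&& z != i, z != j, e j z & ~~ e i z].

Definition shiftv (z x : 'I_k) : 'I_k := if swaps z then tperm i j x else x.

(** Written as the pull-back of [e] along an involution of ordered pairs, so that counts are
    preserved by reindexing. *)
Definition shift : rel 'I_k := fun x y => e (shiftv y x) (shiftv x y).

Lemma swapsP z : swaps z -> [/\ z != i, z != j, tperm i j z = z, e j z & e i z = false].
Proof.
by case/and4P=> zi zj ejz /negbTE eiz; split=> //; rewrite tpermD // eq_sym.
Qed.

Lemma shiftv_inv x y :
  shiftv (shiftv x y) (shiftv y x) = x.
Proof.
rewrite {2 3}/shiftv; case: ifP => [sx|sx]; case: ifP => [sy|sy].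
- have [_ _ tx _ _] := swapsP sx; have [_ _ ty _ _] := swapsP sy.
  by rewrite tx ty /shiftv sy.
- have [xi xj tx _ _] := swapsP sx; rewrite /shiftv.
  by case: ifP.
- by rewrite /shiftv sy tpermK.
- by rewrite /shiftv sy.
Qed.

Lemma shift_sym : symmetric shift.
Proof. by move=> x y; rewrite /shift esym. Qed.

Lemma shift_irr : irreflexive shift.
Proof. by move=> x; rewrite /shift eirr. Qed.

Let sigma (q : 'I_k * 'I_k) := (shiftv q.2 q.1, shiftv q.1 q.2).

Let sigmaK : involutive sigma.
Proof. by case=> x y; rewrite /sigma /= !shiftv_inv. Qed.

Lemma card_nonedges_shift : #|nonedges shift| = #|nonedges e|.
Proof.
rewrite -[RHS](card_preimset _ (inv_inj sigmaK)); apply: eq_card => -[x y].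
rewrite !inE /=; congr (~~ _ && _).
apply/eqP/eqP => [->//|E].
by rewrite -(shiftv_inv x y) -[RHS](shiftv_inv y x) E.
Qed.

(* The transposition of [i] and [j] turns a matching of [shift] that uses an edge
   outside [e] into a matching of [e]. *)
Lemma shift_matching mu : matching shift mu ->
  exists2 nu, matching e nu & #|moved nu| = #|moved mu|.
Proof.
case=> muK emu.
have [/forallP all_e|] := boolP [forall x, (mu x != x) ==> e x (mu x)].
  by exists mu => //; split=> // x; apply/implyP.
rewrite negb_forall => /existsP[x0]; rewrite negb_imply => /andP[mx0 nex0].
have {x0 mx0 nex0} szi : swaps (mu i).
  have := emu _ mx0; rewrite /shift /shiftv.
  case: ifP => [s1|s1]; case: ifP => [s2|s2]; last by rewrite (negbTE nex0).
  - have [_ _ -> _ _] := swapsP s1; have [_ _ -> _ _] := swapsP s2.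
    by rewrite (negbTE nex0).
  - case: tpermP => [Ex _|Ex|]; first by rewrite -Ex.
    + by case/swapsP: s1 => _ _ _; rewrite -Ex (negbTE nex0).
    + by rewrite (negbTE nex0).
  - case: tpermP => [Ex _|Ex|]; first by rewrite -Ex muK.
    + by case/swapsP: s2 => _ _ _; rewrite -Ex esym (negbTE nex0).
    + by rewrite (negbTE nex0).
have [zi zj tz ejz eiz] := swapsP szi.
pose t := tperm i j.
have nswi : ~~ swaps i by rewrite /swaps eqxx.
have nswj : ~~ swaps j by rewrite /swaps eqxx andbF.
(* Now [i] and [j] exchange partners: [mu i] is adjacent to [j] in [e], and an edge from [j] to
   [mu j] survives the shift only if [mu j] is adjacent to [i] too. *)
exists (fun x => t (mu (t x))); last first.
  rewrite -[RHS](card_preimset _ (@perm_inj _ t)); apply: eq_card => x.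
  rewrite !inE; congr (~~ _).
  by rewrite -(inj_eq (@perm_inj _ t)) /t tpermK.
split=> [x|x]; first by rewrite /t tpermK muK tpermK.
rewrite -(inj_eq (@perm_inj _ t)) /t tpermK => mx.
have := emu _ mx; rewrite /shift /shiftv.
move: mx; case: (tpermP i j x) => [->|->|/eqP xi /eqP xj] mx.
- have yi : mu j != i by apply: contraNneq zj => <-; rewrite muK.
  rewrite (negbTE nswj) tpermR; case: ifP => [sy|nsy].
    by have [_ _ -> _ ->] := swapsP sy.
  move=> ejy; rewrite tpermD 1?eq_sym //.
  by move/negbT: nsy; rewrite /swaps yi mx ejy negbK.
- by rewrite tz.
- have [Ex|yi] := eqVneq (mu x) i.
    have Ex' : x = mu i by rewrite -Ex muK.
    by rewrite Ex tpermL (esym x) => _; rewrite Ex'.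
  have [Ey|yj] := eqVneq (mu x) j.
    rewrite Ey tpermR (negbTE nswj); case: ifP => // nsx.
    by rewrite esym => ejx; move/negbT: nsx; rewrite /swaps xi xj ejx negbK esym.
  have [tx tmx] : tperm i j x = x /\ tperm i j (mu x) = mu x.
    by split; apply: tpermD; rewrite eq_sym.
  by rewrite tx tmx !if_same.
Qed.

(** The measure by which repeated shifts towards smaller vertices terminate. *)
Definition weight (r : rel 'I_k) : nat := \sum_(q | r q.1 q.2) (q.1 + q.2).

Lemma shift_weight z : i < j -> swaps z -> weight shift < weight e.
Proof.
move=> ltij sz; rewrite /weight (reindex_inj (inv_inj sigmaK)) /=.
rewrite (eq_bigl (fun q => e q.1 q.2)); last first.
  by case=> x y; rewrite /= /shift !shiftv_inv.
(* No edge of [e] joins a swapped vertex to [i], so the transposition can only send [j] down to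
   [i]. *)
have le_t a b : e a b -> shiftv b a <= a.
  rewrite /shiftv; case: ifP => // /swapsP[bi bj _ ejb eib].
  by case: tpermP => [->|->|//]; rewrite ?eib // => _; apply: ltnW.
have [zi zj tz ejz eiz] := swapsP sz.
rewrite (bigD1 (j, z)) //= [X in _ < X](bigD1 (j, z)) //= -addSn; apply: leq_add.
  by rewrite -addSn leq_add ?(le_t z j) 1?esym // /shiftv sz tpermR.
apply: leq_sum => -[a b] /andP[/= eab _].
by rewrite leq_add ?le_t // esym.
Qed.
End Shift.

(* If the pairs {x, 2 s + 1 - x} are not all edges, say {a, b} is not one with
   a < b, then every edge meets [0, a) or lies in [0, b). *)
Lemma shifted_nonedges k s (e : rel 'I_k) :
  symmetric e -> irreflexive e -> 2 * s + 2 <= k ->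
  (forall i j z : 'I_k, i < j -> ~~ swaps e i j z) ->
  (forall mu, matching e mu -> #|moved mu| < 2 * s + 2) ->
  exists2 a, a <= s &
    (k - a) * (k - a).-1 <= #|nonedges e| + (2 * (s - a)).+1 * (2 * (s - a)).
Proof.
move=> esym eirr le_k shifted small.
have down (x x' y : 'I_k) : x' <= x -> y != x' -> e x y -> e x' y.
  rewrite leq_eqVlt => /orP[/eqP/val_inj->//|lt] yx' exy.
  have := shifted _ _ y lt; rewrite /swaps yx' exy.
  by case: (eqVneq y x) exy => [->|_ _]; rewrite ?eirr //= negbK.
(* As 2 s + 1 is odd, this involution moves each of the first 2 s + 2 vertices: one edge too many
   for a matching. *)
have lt_mu (x : 'I_k) : (if x < 2 * s + 2 then 2 * s + 1 - x else x) < k.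
  by case: ifP => //; lia.
pose mu x := Ordinal (lt_mu x).
have muK : involutive mu.
  by move=> x; apply: val_inj; rewrite /=; case: ifP; case: ifP; lia.
have [a [b [nab le_a Eb]]] : exists a b : 'I_k, [/\ ~~ e a b, a <= s & a + b = 2 * s + 1].
  have [/forallP all_e|] := boolP [forall x, (mu x != x) ==> e x (mu x)].
    have /small : matching e mu by split=> // x; apply/implyP.
    suff -> : #|moved mu| = 2 * s + 2 by rewrite ltnn.
    have -> : moved mu = [set widen_ord le_k x | x : 'I_(2 * s + 2)].
      apply/setP=> x; rewrite inE; apply/idP/imsetP => [|[y _ ->]].
        rewrite -val_eqE /=; case: ifP => [lt _|]; last by rewrite eqxx.
        by exists (Ordinal lt) => //; apply: val_inj.
      by rewrite -val_eqE /= ltn_ord; have := ltn_ord y; lia.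
    rewrite card_imset ?card_ord // => x y /(congr1 val) /= E.
    exact: val_inj.
  rewrite negb_forall => /existsP[x]; rewrite negb_imply -val_eqE /=.
  case/andP; case: ifP => [lt_x _|]; last by rewrite eqxx.
  move=> nex; have [le_xs|lt_sx] := leqP x s.
    by exists x, (mu x); split => //=; rewrite lt_x; lia.
  exists (mu x), x; split; rewrite 1?esym //= lt_x; lia.
exists (a : nat) => //.
have neq_ab : b != a :> nat by lia.
have eP (x y : 'I_k) : a <= x -> b <= y -> ~~ e x y.
  move=> ax by_; apply: contra nab => exy.
  have eay : e a y by apply: (down x) => //; rewrite -val_eqE /=; lia.
  by rewrite esym; apply: (down y) => //; rewrite 1?esym // eq_sym -val_eqE.
pose ge_a : {set 'I_k} := [set x : 'I_k | a <= x].
pose mid : {set 'I_k} := [set x : 'I_k | a <= x < b].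
have card_itv c d : d <= k -> #|[set x : 'I_k | c <= x < d]| = d - c.
  move=> le_d; rewrite -sum1_card -[RHS]muln1 -sum_nat_const_nat big_geq_mkord /=.
  rewrite (big_ord_widen_cond k (fun x => c <= x) (fun=> 1)) //.
  by apply: eq_bigl => x; rewrite inE.
have -> : (k - a) * (k - a).-1 = #|offdiag ge_a|.
  rewrite card_offdiag; suff -> : #|ge_a| = k - a by [].
  rewrite -(card_itv _ _ (leqnn k)); apply: eq_card => x.
  by rewrite !inE ltn_ord andbT.
have -> : (2 * (s - a)).+1 * (2 * (s - a)) = #|offdiag mid|.
  rewrite card_offdiag card_itv; last exact: ltnW.
  by have -> : b - a = (2 * (s - a)).+1 by lia.
apply: leq_trans (leq_card_setU _ _); apply/subset_leq_card/subsetP => -[x y].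
rewrite !inE /= => /and3P[xy ax ay]; rewrite xy ax ay /=.
have [bx|lt_xb] := leqP b x; first by rewrite esym eP.
have [by_|lt_yb] := leqP b y; first by rewrite eP.
by rewrite orbT.
Qed.

(* [nonedges] consists of ordered pairs. The extremal graphs join a complete graph
   on [a] vertices to a complete graph on 2 (s - a) + 1 vertices and isolated ones. *)
Lemma erdos_gallai k s (e : rel 'I_k) :
  symmetric e -> irreflexive e -> 2 * s + 2 <= k ->
  (forall mu, matching e mu -> #|moved mu| < 2 * s + 2) ->
  exists2 a, a <= s &
    (k - a) * (k - a).-1 <= #|nonedges e| + (2 * (s - a)).+1 * (2 * (s - a)).
Proof.
move=> + + le_k; have [n] := ubnP (weight e); elim: n e => // n IHn e.
rewrite ltnS => le_n esym eirr small.
have [/existsP[i /existsP[j /existsP[z /andP[ltij sz]]]]|shifted] :=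
    boolP [exists i : 'I_k, exists j : 'I_k, exists z, (i < j) && swaps e i j z].
  rewrite -(card_nonedges_shift e i j); apply: IHn.
  - exact: leq_trans (shift_weight esym ltij sz) le_n.
  - exact: shift_sym.
  - exact: shift_irr.
  - by move=> mu /(shift_matching esym)[nu /small + <-].
apply: shifted_nonedges => // i j z ltij; apply: contra shifted => sz.
apply/existsP; exists i; apply/existsP; exists j.
by apply/existsP; exists z; rewrite ltij.
Qed.

(** * Cover-free families and pairs contained in a single member *)

Section CoverFree.
Variables (T I : finType) (F : I -> {set T}).

Definition cover_free d (U : {set T}) (V : {set I}) : Prop :=
  forall (c : I) (D : {set I}), c \in V -> D \subset V -> c \notin D -> #|D| <= d ->
  exists2 x, x \in U :&: F c & forall j, j \in D -> x \notin F j.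

Definition only_in c (V : {set I}) (S : {set T}) : bool :=
  [forall j in V, (S \subset F j) ==> (j == c)].

Definition own_pairs (U : {set T}) (V : {set I}) c : {set T * T} :=
  [set q : T * T | [&& q.1 != q.2, q.1 \in U :&: F c, q.2 \in U :&: F c
                     & only_in c V [set q.1; q.2]]].

(** The point [x] lies in no member other than [c], so it never serves as a witness for another
    one. *)
Lemma cover_free_del_own d (U : {set T}) (V : {set I}) c x :
  cover_free d U V -> only_in c V [set x] ->
  cover_free d (U :\ x) (V :\ c).
Proof.
move=> cf own c' D; rewrite in_setD1 => /andP[c'c Vc'] DV c'D le_d.
have [y] := cf c' D Vc' (subset_trans DV (subsetDl _ _)) c'D le_d.
rewrite inE => /andP[Uy Fy] Dy; exists y => //.
rewrite !inE Uy Fy !andbT; apply: contraNneq c'c => Ey.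
by have /forall_inP/(_ _ Vc') := own; rewrite sub1set -Ey Fy.
Qed.

(** Adding [c] to the covering members costs one unit of [d] and puts the witness outside [F c]. *)
Lemma cover_free_del_column d (U : {set T}) (V : {set I}) c : c \in V ->
  cover_free d.+1 U V -> cover_free d (U :\: F c) (V :\ c).
Proof.
move=> Vc cf c' D; rewrite in_setD1 => /andP[c'c Vc'] DV c'D le_d.
have sDV : c |: D \subset V.
  by rewrite subUset sub1set Vc (subset_trans DV (subsetDl _ _)).
have c'cD : c' \notin c |: D by rewrite !inE negb_or c'c.
have [|y Uy Dy] := cf c' (c |: D) Vc' sDV c'cD.
  by rewrite cardsU1; case: (c \notin D) => /=; lia.
exists y => [|j jD]; last by apply: Dy; rewrite !inE jD orbT.
by move: Uy (Dy c); rewrite !inE eqxx => /andP[-> ->] ->.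
Qed.

Lemma sum_own_pairs (U : {set T}) (V : {set I}) :
  \sum_(c in V) #|own_pairs U V c| <= #|U| * #|U|.-1.
Proof.
rewrite -card_offdiag.
under eq_bigr do rewrite -sum1_card.
rewrite (exchange_big_dep (mem (offdiag U))) /=; last first.
  by move=> c [x y] _; rewrite !inE /= => /and4P[-> /andP[-> _] /andP[-> _] _].
rewrite -[leqRHS]sum1_card; apply: leq_sum => -[x y] _.
rewrite sum1_card; apply/card_le1_eqP => c c'.
move=> /andP[_ +] /andP[Vc' +]; rewrite !inE /=.
move=> /and4P[_ _ _ own] /and4P[_ /andP[_ Fx] /andP[_ Fy] _].
have /forall_inP/(_ _ Vc') := own.
by rewrite subUset !sub1set Fx Fy => /eqP.
Qed.

(* An edge is covered by one other member, an unmatched point by another one. *)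
Lemma matching_upper_bound d (U : {set T}) (V : {set I}) c mu
    (A := U :&: F c) (e := fun x y : 'I_#|A| =>
    (x != y) && ~~ only_in c V [set enum_val x; enum_val y]) :
  cover_free d U V -> c \in V ->
  (forall x, x \in A -> ~~ only_in c V [set x]) ->
  matching e mu -> #|moved mu| + 2 * d.+1 <= 2 * #|A|.
Proof.
move=> cf Vc nown [muK emu].
have hP x : exists j, [&& j \in V, j != c, enum_val x \in F j & enum_val (mu x) \in F j].
  have [E|mx] := eqVneq (mu x) x.
    have := nown _ (enum_valP x); rewrite E negb_forall => /existsP[j].
    rewrite !negb_imply sub1set => /and3P[Vj Fj jc].
    by exists j; rewrite Vj jc Fj.
  have /andP[_] := emu x mx; rewrite negb_forall => /existsP[j].
  rewrite !negb_imply subUset !sub1set => /and3P[Vj /andP[Fj Fj'] jc].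
  by exists j; rewrite Vj jc Fj.
pose h x := xchoose (hP x).
have hV x : h x \in V by case/and4P: (xchooseP (hP x)).
have hc x : h x != c by case/and4P: (xchooseP (hP x)).
have hF x : enum_val x \in F (h x) by case/and4P: (xchooseP (hP x)).
have hF' x : enum_val (mu x) \in F (h x) by case/and4P: (xchooseP (hP x)).
(* One end of each edge and all unmatched points: the members [h x] for these cover [F c] within
   [U], so there are more than [d] of them. *)
pose P := [set x : 'I_#|A| | x <= mu x].
have lt_d : d < #|P|.
  rewrite ltnNge; apply/negP => le_d.
  have [|||x Ax xD] := cf c (h @: P) Vc.
  - by apply/subsetP=> _ /imsetP[x _ ->].
  - by apply/imsetP => -[x _ E]; have := hc x; rewrite -E eqxx.
  - exact: leq_trans (leq_imset_card _ _) le_d.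
  pose y := enum_rank_in Ax x.
  have Ey : enum_val y = x by rewrite enum_rankK_in.
  have xDh (z : 'I_#|A|) : z <= mu z -> x \notin F (h z).
    by move=> le_z; apply/xD/imset_f; rewrite inE.
  have [/xDh|/ltnW le_y] := leqP y (mu y); first by rewrite -Ey hF.
  by have := hF' (mu y); have := xDh (mu y); rewrite muK Ey => /(_ le_y)/negbTE->.
pose Q := [set x : 'I_#|A| | mu x < x].
pose Q' := [set x : 'I_#|A| | x < mu x].
have EQ : #|Q'| = #|Q|.
  rewrite -[RHS](card_preimset _ (inv_inj muK)); apply: eq_card => x.
  by rewrite !inE muK.
have EPQ : #|P| + #|Q| = #|A|.
  rewrite -[RHS]card_ord -(cardsC P); congr (_ + _); apply: eq_card => x.
  by rewrite !inE ltnNge.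
have EM : #|moved mu| = #|Q| + #|Q'|.
  rewrite -cardsUI (_ : Q :&: Q' = set0) ?cards0 ?addn0; last first.
    by apply/setP=> x; rewrite !inE; case: ltngtP.
  by apply: eq_card => x; rewrite !inE -val_eqE neq_ltn.
by rewrite EM EQ; lia.
Qed.

(** Erdos-Gallai with s = k - d - 1, where [k <= 2 * d] gives 2 s + 2 <= k. With [k'] = k - a one
    has s - a = [k'] - d - 1, so the bound depends on [k'] and [d] alone. *)
Lemma card_own_pairs d (U : {set T}) (V : {set I}) c (k := #|U :&: F c|) :
  cover_free d U V -> c \in V ->
  (forall x, x \in U :&: F c -> ~~ only_in c V [set x]) ->
  k <= 2 * d ->
  exists2 k', d < k' <= k &
    k' * k'.-1 <= #|own_pairs U V c| + (2 * (k' - d.+1)).+1 * (2 * (k' - d.+1)).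
Proof.
move=> cf Vc nown le_k.
pose A := U :&: F c.
pose e := fun x y : 'I_#|A| =>
    (x != y) && ~~ only_in c V [set enum_val x; enum_val y].
have lower mu : matching e mu -> #|moved mu| + 2 * d.+1 <= 2 * k.
  by apply: matching_upper_bound.
have lt_dk : d < k.
  have /lower : matching e id by split=> // x; rewrite eqxx.
  lia.
have esym : symmetric e by move=> x y; rewrite /e eq_sym setUC.
have eirr : irreflexive e by move=> x; rewrite /e eqxx.
have [||a le_a] := @erdos_gallai _ (k - d.+1) e esym eirr.
- by rewrite -/k; lia.
- by move=> mu /lower; lia.
have le_non : #|nonedges e| <= #|own_pairs U V c|.
  pose f (q : 'I_#|A| * 'I_#|A|) := (enum_val q.1, enum_val q.2).
  have injf : injective f by move=> [x y] [x' y'] [/enum_val_inj -> /enum_val_inj ->].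
  rewrite -(card_imset _ injf); apply/subset_leq_card/subsetP => _ /imsetP[[x y] + ->].
  rewrite !inE /e /= => /andP[xy]; rewrite xy /= negbK => ->.
  have := enum_valP x; have := enum_valP y; rewrite !inE => -> ->.
  by rewrite (inj_eq enum_val_inj) xy.
move=> le1; exists (k - a); first lia.
have -> : k - a - d.+1 = k - d.+1 - a by lia.
by apply: leq_trans le1 _; rewrite leq_add2r.
Qed.
End CoverFree.

(** * The quadratic lower bound for cover-free families *)

Local Open Scope ring_scope.

(* The right-hand side is concave in [x]; at [x = d + 1] the bound is clear, and
   at [x = g (2 d - 1)] the quadratic terms in [d] agree by the equation for [g]. *)
Lemma own_pairs_estimate (R : realFieldType) (g d x : R) :
  12 * g ^+ 2 - 15 * g + 4 = 0 -> 43 / 50 <= g -> g <= 7 / 8 ->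
  2 <= d -> d + 1 <= x -> x < g * (2 * d - 1) ->
  g * d ^+ 2 - 1 <= x * (x - 1) - (2 * (x - (d + 1)) + 1) * (2 * (x - (d + 1))).
Proof.
move=> g_root g_lo g_hi d2 lo hi.
have g1 : 0 <= 1 - g by lra.
pose f y : R :=
  y * (y - 1) - (2 * (y - (d + 1)) + 1) * (2 * (y - (d + 1))) - (g * d ^+ 2 - 1).
pose u := d + 1; pose v := g * (2 * d - 1).
have fu : 0 <= f u.
  have -> : f u = (1 - g) * d ^+ 2 + d + 1 by rewrite /f /u; ring.
  have := mulr_ge0 g1 (sqr_ge0 d); lra.
have fv : 0 <= f v.
  have -> : f v = (12 * g ^+ 2 + 2 * g - 6) * d - (3 * g ^+ 2 + 5 * g + 1)
                  - (12 * g ^+ 2 - 15 * g + 4) * d ^+ 2 by rewrite /f /v; ring.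
  have g2_lo : (43 / 50) ^+ 2 <= g ^+ 2 by rewrite ler_pXn2r ?nnegrE //; lra.
  have g2_hi : g ^+ 2 <= (7 / 8) ^+ 2 by rewrite ler_pXn2r ?nnegrE //; lra.
  (* As d >= 2, the linear term is at least 8, while 3 g^2 + 5 g + 1 < 8 for g <= 7/8. *)
  have slope : 4 <= 12 * g ^+ 2 + 2 * g - 6 by lra.
  have := ler_pM (ler0n R 4) (ler0n R 2) slope d2; rewrite g_root; lra.
(* Interpolation of [f] at [u] and [v]; its leading coefficient is -3. *)
have E : (v - u) * f x = 3 * (v - u) * (x - u) * (v - x) + (v - x) * f u + (x - u) * f v.
  by rewrite /f; ring.
have ux : 0 <= x - u by rewrite /u; lra.
have vx : 0 < v - x by rewrite /v; lra.
have vu : 0 < v - u by lra.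
rewrite -subr_ge0 -[X in 0 <= X]/(f x) -(pmulr_rge0 _ vu) E.
have := mulr_ge0 (mulr_ge0 (ltW vu) ux) (ltW vx).
have := mulr_ge0 (ltW vx) fu; have := mulr_ge0 ux fv; lra.
Qed.

Theorem cover_free_lower_bound (R : realFieldType) (g : R)
    (T I : finType) (F : I -> {set T}) d (U : {set T}) (V : {set I}) :
  12 * g ^+ 2 - 15 * g + 4 = 0 -> 43 / 50 <= g -> g <= 7 / 8 ->
  cover_free F d U V -> (#|U| < #|V|)%N -> g * d%:R ^+ 2 <= #|U|%:R.
Proof.
move=> g_root g_lo g_hi; have [n] := ubnP #|U|.
elim: n d U V => // n IHn [|d] U V; rewrite ltnS => le_n cf ltUV.
  by rewrite expr0n mulr0.
rewrite leNgt; apply/negP => small.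
have k_gt0 c : c \in V -> (0 < #|U :&: F c|)%N.
  move=> Vc; have [|||x Ux _] := cf c set0 Vc; rewrite ?sub0set ?inE ?cards0 //.
  by apply/card_gt0P; exists x.
have cardV c : c \in V -> #|V| = (#|V :\ c|).+1 by move=> Vc; rewrite (cardsD1 c) Vc.
have nown c : c \in V -> forall x, x \in U :&: F c -> ~~ only_in F c V [set x].
  move=> Vc x; rewrite inE => /andP[Ux Fx]; apply/negP => own.
  have cardU : #|U| = (#|U :\ x|).+1 by rewrite (cardsD1 x) Ux.
  have := IHn _ _ _ _ (cover_free_del_own cf own).
  move: le_n ltUV small; rewrite cardU (cardV _ Vc) !ltnS => le_n ltUV small.
  move/(_ le_n ltUV); move: small; rewrite -(natr1 #|_|); lra.
(* Deleting [c] leaves at least g d^2 of fewer than g (d + 1)^2 points. *)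
have k_lt c : c \in V -> #|U :&: F c|%:R < g * (2 * d.+1%:R - 1).
  move=> Vc; have := IHn _ _ _ _ (cover_free_del_column Vc cf).
  have := k_gt0 _ Vc; have := cardsID (F c) U.
  move: small; move: #|U :&: F c| #|U :\: F c| => k m small Ek k0.
  move: le_n ltUV small; rewrite -Ek (cardV _ Vc) => le_n ltUV small.
  have lt1 : (m < n)%N by lia.
  have lt2 : (m < #|V :\ c|)%N by lia.
  move/(_ lt1 lt2); move: small; rewrite natrD -(natr1 d); nra.
(* The estimate gives more than |U| - 1 ordered own pairs; integrality gives |U|. *)
have own_ge c : c \in V -> (#|U| <= #|own_pairs F U V c|)%N.
  move=> Vc; have k0 := k_gt0 _ Vc; have kg := k_lt _ Vc.
  have d_gt0 : (0 < d)%N.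
    case: d kg {IHn cf small k_lt} => // kg.
    have : (1%:R : R) <= #|U :&: F c|%:R by rewrite ler_nat.
    lra.
  have d1 : (1 : R) <= d%:R by rewrite ler1n.
  have le_k : (#|U :&: F c| <= 2 * d.+1)%N.
    rewrite -(ler_nat R) natrM -(natr1 d); move: kg; rewrite -(natr1 d); nra.
  have [k' /andP[lt_dk le_k'] ] := card_own_pairs cf Vc (nown _ Vc) le_k.
  have k'_pos : (0 < k')%N by lia.
  rewrite -(ler_nat R) natrD !natrM -(natr1 (2 * _)%N) natrM natrB // => own.
  have Epred : (k'.-1%:R = k'%:R - 1 :> R) by rewrite -subn1 natrB.
  have := @own_pairs_estimate R g d.+1%:R k'%:R.
  move/(_ g_root g_lo g_hi); rewrite natr1 ler_nat ltnS d_gt0 ler_nat lt_dk.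
  move=> /(_ isT isT).
  have le_kR : (k'%:R : R) <= #|U :&: F c|%:R by rewrite ler_nat.
  move/(_ (le_lt_trans le_kR kg)) => est.
  rewrite -ltnS -(ltr_nat R) -natr1; move: own est small.
  rewrite Epred; lra.
have [c Vc] : exists c, c \in V by apply/card_gt0P; apply: leq_ltn_trans ltUV.
have U_gt0 : (0 < #|U|)%N.
  by apply: leq_trans (k_gt0 _ Vc) (subset_leq_card (subsetIl _ _)).
have := sum_own_pairs F U V; rewrite leqNgt => /negP[].
have : (\sum_(c in V) #|U| <= \sum_(c in V) #|own_pairs F U V c|)%N by apply: leq_sum.
rewrite sum_nat_const; apply: leq_trans.
by rewrite mulnC ltn_mul2r U_gt0; apply: leq_ltn_trans ltUV; rewrite leq_pred.
Qed.
Local Close Scope ring_scope.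

(** * From separating hash families to cover-free families *)

Lemma subset_of_card (I : finType) (A B : {set I}) m :
  A \subset B -> #|A| <= m <= #|B| ->
  exists2 C : {set I}, A \subset C & C \subset B /\ #|C| = m.
Proof.
move=> sAB /andP[leA leB].
have : 0 < #|[set C : {set I} | C \subset B :\: A & #|C| == m - #|A|]|.
  by rewrite cards_draws bin_gt0 cardsDS // leq_sub2r.
case/card_gt0P => C; rewrite inE subsetD => /andP[/andP[CB dis] /eqP cC].
exists (A :|: C); first exact: subsetUl.
rewrite subUset sAB CB cardsU disjoint_setI0 1?disjoint_sym // cards0 subn0 cC.
by rewrite subnKC.
Qed.

Section DifferenceSets.
Variables (N n : nat) (A : 'M[bool]_(N, n)).

Definition diff_rows (c j : 'I_n) : {set 'I_N} := [set i | A i j != A i c].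

(** Separate [x] from [D] and [c] together: in a row where [x] differs from all of them, binary
    entries make [D] agree with [c]. *)
Lemma diff_rows_cover_free w c :
  is_SHF w.+1 A -> cover_free (diff_rows c) w setT [set~ c].
Proof.
case/andP=> lt_wn /forallP sep x D; rewrite in_setC1 => xc sD xD le_D.
have cD : c \notin D by apply/negP => /(subsetP sD); rewrite !inE eqxx.
have [||C sC [CB cC]] := @subset_of_card _ (c |: D) [set~ x] w.+1.
- by rewrite subsetC sub1set !inE negb_or xc xD.
- by rewrite cardsU1 cD add1n ltnS le_D cardsC1 card_ord; lia.
have /forallP/(_ C)/implyP := sep x.
rewrite -in_setC -sub1set subsetC CB cC eqxx => /(_ isT)/existsP[i /forall_inP iP].
have ic : A i x != A i c by apply: iP; rewrite (subsetP sC) ?setU11.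
exists i; first by rewrite !inE.
move=> j jD; rewrite inE negbK.
have := iP j (subsetP sC _ (setU1r _ jD)); move: ic.
by case: (A i x) (A i c) (A i j) => [] [] [].
Qed.

(** A row separating [c] from other columns lies in all their difference sets; cover-freeness gives
    one of these columns a further row. *)
Lemma diff_rows_ge2 w c : is_SHF w.+2 A -> exists2 x, x != c & 1 < #|diff_rows c x|.
Proof.
move=> shf; have cf := diff_rows_cover_free (c := c) shf.
case/andP: shf => lt_wn /forallP sep.
have [|C _ [CB cC]] := @subset_of_card _ set0 [set~ c] w.+2 (sub0set _).
  by rewrite cards0 cardsC1 card_ord; lia.
have /forallP/(_ C)/implyP := sep c.
rewrite -in_setC -sub1set subsetC CB cC eqxx => /(_ isT)/existsP[i /forall_inP iP].
have /card_gt1P[x [y [Cx Cy xy]]] : 1 < #|C| by rewrite cC.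
have [||||i' + i'y] := cf x [set y].
- exact: (subsetP CB).
- by rewrite sub1set (subsetP CB).
- by rewrite inE.
- by rewrite cards1.
rewrite !inE => i'x; exists x; first by have := subsetP CB _ Cx; rewrite !inE.
apply/card_gt1P; exists i, i'; split; rewrite ?inE //; first by rewrite eq_sym iP.
apply: contraNneq (i'y y _) => [<-|]; rewrite ?inE // eq_sym; exact: iP.
Qed.

(** Two columns, [c] and [x], are lost, so at least two rows must go with [x] to keep more columns
    than rows. *)
Lemma SHF_lower_bound (R : realFieldType) (g : R) w :
  (12 * g ^+ 2 - 15 * g + 4 = 0)%R -> (43 / 50 <= g <= 7 / 8)%R ->
  is_SHF w.+2 A -> N < n -> (g * w%:R ^+ 2 <= N%:R)%R.
Proof.
move=> g_root /andP[g_lo g_hi] shf ltNn.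
have lt_wn : w.+2 < n by case/andP: shf.
pose c : 'I_n := Ordinal (leq_trans (ltn0Sn _) lt_wn).
have cf := diff_rows_cover_free (c := c) shf.
have [x xc gt1] := diff_rows_ge2 c shf.
have Vx : x \in [set~ c] by rewrite !inE.
have := cover_free_lower_bound g_root g_lo g_hi (cover_free_del_column Vx cf).
have := cardsC (diff_rows c x); rewrite setTD card_ord => EN.
have EV : (#|[set~ c] :\ x|).+2 = n.
  by have := cardsC1 c; rewrite card_ord (cardsD1 x) Vx; lia.
have lt1 : #|~: diff_rows c x| < #|[set~ c] :\ x| by lia.
move/(_ lt1)=> le; apply: Order.POrderTheory.le_trans le _.
by rewrite ler_nat; lia.
Qed.
End DifferenceSets.

Local Open Scope ring_scope.

Theorem theorem6p1 (R : rcfType) (w : nat) (hw : (3 <= w)%N) :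
  (forall N : nat,
     N%:R < (15 + Num.sqrt 33) / 24 * (w%:R - 2) ^+ 2 :> R ->
     (SHF_C N w <= N)%N) /\
  (15 + Num.sqrt 33) / 24 * (w%:R - 2) ^+ 2 <= (SHF_N w)%:R :> R.
Proof.
have main N n : (N < n)%N -> has_SHF N n w ->
    (15 + Num.sqrt 33) / 24 * (w%:R - 2) ^+ 2 <= N%:R :> R.
  case: w hw => [|[|v]] // _ ltNn /existsP[A shf].
  have sq : Num.sqrt 33 ^+ 2 = 33 :> R by rewrite sqr_sqrtr ?ler0n.
  have s0 : 0 <= Num.sqrt 33 :> R by rewrite sqrtr_ge0.
  rewrite -natrB // subn2 /=; apply: SHF_lower_bound shf ltNn.
    by move: sq; set s := Num.sqrt 33; nra.
  by apply/andP; split; move: sq s0; set s := Num.sqrt 33; nra.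
split=> [N small|]; last first.
  by have [n lt_n] := SHF_N_attained (ltnW (ltnW hw)); apply: main.
apply/bigmax_leqP => n shf; rewrite leqNgt; apply/negP => ltNn.
by have := main _ _ ltNn shf; rewrite leNgt small.
Qed.
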